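(* Let $1\le k\le n$, let $\ell\in\{0,\dots,k-1\}$, let $A\subseteq[n]$ with $|A|=\ell$, and let $\sigma\in\mathcal D_{k-1,n}$ be a decorated permutation with $k-1$ weak excedances (i.e. of rank $k-1$). If $\sigma=\overleftarrow{\rho_A}(\pi_{k,n})$, then $\sigma\lessdot\pi_{k,n}$; that is, the positroid $P_\sigma$ is a quotient of the uniform matroid $U_{k,n}=P_{\pi_{k,n}}$.
   Context: Notation: $[n]=\{1,\dots,n\}$. $U_{k,n}$ is the uniform matroid of rank $k$ on $[n]$ (bases: all $k$-subsets of $[n]$). Quotients: for matroids $M,N$ on the same ground set, $M$ is a quotient of $N$ if every circuit of $N$ is a union of circuits of $M$. Decorated permutations: a decorated permutation of $[n]$ is a bijection $\sigma:[n]\to[n]$ together with a decoration of each fixed point $i$ as either $\sigma(i)=\underline{i}$ or $\sigma(i)=\overline{i}$. For $i\in[n]$ let $<_i$ be the total order $i<_i i+1<_i\cdots<_i n<_i 1<_i\cdots<_i i-1$. An element $j\in[n]$ is a weak $i$-excedance of $\sigma$ if $\sigma(j)=\overline{j}$ or $j<_i\sigma(j)$; $W_i(\sigma)$ is the set of weak $i$-excedances. The number $|W_i(\sigma)|$ does not depend on $i$ and is the number of weak excedances of $\sigma$. $\mathcal D_{k,n}$ is the set of decorated permutations of $[n]$ with $k$ weak excedances. Positroids: for $k$-subsets $S=\{s_1<_i\cdots<_i s_k\}$ and $T=\{t_1<_i\cdots<_i t_k\}$ write $S\le_i T$ if $s_j\le_i t_j$ for all $j$. For $\sigma\in\mathcal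 D_{k,n}$, the positroid $P_\sigma$ is the rank-$k$ matroid on $[n]$ whose bases are the $k$-subsets $B$ of $[n]$ with $B\ge_i W_i(\sigma)$ for all $i\in[n]$. For $\tau\in\mathcal D_{k-1,n}$ and $\pi\in\mathcal D_{k,n}$, write $\tau\lessdot\pi$ if $P_\tau$ is a quotient of $P_\pi$. Uniform permutation: $\pi_{k,n}\in\mathcal D_{k,n}$ is given by $\pi_{k,n}(i)\equiv n-k+i \pmod n$, i.e. in one-line notation $(n-k+1)\cdots n\,1\,2\cdots(n-k)$ (for $k=n$ all fixed points are overlined, for $k=0$ all are underlined). One has $P_{\pi_{k,n}}=U_{k,n}$. Cyclic shift: for a decorated permutation $\pi$ of $[n]$ (in one-line notation) and $A\subseteq[n]$, $\overleftarrow{\rho_A}(\pi)$ is obtained by the following moves in order: (F) freeze the value $i$ in $\pi$ if and only if $i\in A$; (S) cyclically shift the remaining (unfrozen) values one place to the left, jumping over frozen values (so each unfrozen position receives the value of the next unfrozen position to its right, cyclically); (D) decorate any fixed point $i$ appearing after the shift (at an unfrozen position) as $\underline{i}$; frozen fixed points keep their decoration. Example: for $\pi=34512$, $\overleftarrow{\rho_{\{2,5\}}}(\pi)=41532$ and $\overleftarrow{\rho_{\{1,2\}}}(\pi)=45\underline{3}12$. *)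

(* Defs.v *)
From mathcomp Require Import all_boot all_fingroup.
From mathcomp Require Import zify.

Set Implicit Arguments.
Unset Strict Implicit.
Unset Printing Implicit Defensive.

(** The ground set [n] = {1, ..., n} is encoded as
    'I_n = {0, ..., n-1} via i |-> i - 1. *)

Record matroid (T : finType) := Matroid {
  bases : {set {set T}};
  bases_neq0 : bases != set0;
  bases_exchange : forall (B1 B2 : {set T}) (x : T),
    B1 \in bases -> B2 \in bases -> x \in B1 :\: B2 ->
    exists2 y, y \in B2 :\: B1 & y |: (B1 :\ x) \in bases
}.

Section Matroid.
Variable T : finType.
Implicit Types (M N : matroid T) (I C : {set T}).

Definition indep M I : bool := [exists B in bases M, I \subset B].

Definition circuit M C : bool := minset (fun D => ~~ indep M D) C.

(** [quotient_of M N]: M is a quotient of N. *)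
Definition quotient_of M N : Prop :=
  forall C, circuit N C ->
    exists2 S : {set {set T}}, (forall D, D \in S -> circuit M D) & C = cover S.

End Matroid.

Lemma uniform_neq0 n k : k <= n -> [set B : {set 'I_n} | #|B| == k] != set0.
Proof.
move=> hk; apply/set0Pn; exists [set widen_ord hk i | i : 'I_k].
rewrite inE card_imset ?card_ord // => i j /(congr1 val) /= e; exact: val_inj.
Qed.

Lemma uniform_exchange n k (B1 B2 : {set 'I_n}) (x : 'I_n) :
  B1 \in [set B : {set 'I_n} | #|B| == k] ->
  B2 \in [set B : {set 'I_n} | #|B| == k] -> x \in B1 :\: B2 ->
  exists2 y, y \in B2 :\: B1 & y |: (B1 :\ x) \in [set B : {set 'I_n} | #|B| == k].
Proof.
rewrite !inE => /eqP c1 /eqP c2 /andP[xB2 xB1].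
have /set0Pn[y yD] : B2 :\: B1 != set0.
  rewrite setD_eq0; apply: contra xB2 => sB.
  by have /eqP-> : B2 == B1 by rewrite eqEcard sB c1 c2 leqnn.
exists y => //; move: yD; rewrite !inE => /andP[yB1 _].
by rewrite cardsU1 !inE negb_and yB1 orbT -c1 (cardsD1 x B1) xB1.
Qed.

Definition uniform n k (hk : k <= n) : matroid 'I_n :=
  Matroid (uniform_neq0 hk) (@uniform_exchange n k).

(** [over s] is the set of overlined fixed points; the other fixed points are
    underlined. *)
Record dperm n := DPerm {
  dfun : {perm 'I_n};
  over : {set 'I_n};
  over_fixed : [forall i in over, dfun i == i]
}.

(** 0-based rank of [j] in the total order i <_i i+1 <_i ... <_i i-1. *)
Definition cpos n (i j : 'I_n) : nat := (j + (n - i)) %% n.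

Definition cle n (i : 'I_n) : rel 'I_n := fun a b => cpos i a <= cpos i b.
Definition clt n (i : 'I_n) : rel 'I_n := fun a b => cpos i a < cpos i b.

Definition wexc n (s : dperm n) (i : 'I_n) : {set 'I_n} :=
  [set j | (j \in over s) || clt i j (dfun s j)].

(** The cardinal of W_1 (natural order), stated so as to make sense for n = 0
    too; [card_wexc] below shows that it is the cardinal of every W_i. *)
Definition num_wexc n (s : dperm n) : nat :=
  #|[set j : 'I_n | (j \in over s) || (j < dfun s j)]|.

Definition gale_le n (i : 'I_n) (S T : {set 'I_n}) : bool :=
  all2 (cle i) (sort (cle i) (enum S)) (sort (cle i) (enum T)).

Definition positroid_bases n (s : dperm n) : {set {set 'I_n}} :=
  [set B : {set 'I_n} |
    (#|B| == num_wexc s) && [forall i, gale_le i (wexc s i) B]].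

Section CyclicOrder.
Variable n : nat.
Implicit Types (i j x : 'I_n) (s : dperm n) (S T B : {set 'I_n}).

Lemma cposE i j : cpos i j = if i <= j then j - i else j + n - i.
Proof.
have hi := ltn_ord i; have hj := ltn_ord j; rewrite /cpos; case: leqP => h.
  by rewrite (_ : j + (n - i) = n + (j - i)) ?modnDl ?modn_small; lia.
by rewrite modn_small; lia.
Qed.

Lemma cpos_lt i j : cpos i j < n.
Proof. by rewrite ltn_pmod // (leq_ltn_trans _ (ltn_ord i)). Qed.

Lemma cpos_inj i : injective (cpos i).
Proof.
move=> a b; rewrite !cposE => h; apply: val_inj => /=.
have ha := ltn_ord a; have hb := ltn_ord b; have hi := ltn_ord i.
by move: h; case: leqP => ?; case: leqP => ?; lia.
Qed.

Lemma cpos_trans i j x :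
  cpos i j + cpos j x = cpos i x + (if cpos i x < cpos i j then n else 0).
Proof.
have hi := ltn_ord i; have hj := ltn_ord j; have hx := ltn_ord x.
rewrite !cposE; case: (leqP i j) => ?; case: (leqP j x) => ?;
  case: (leqP i x) => ?; case: ltnP => ?; lia.
Qed.

Lemma cposD i j x :
  cpos i j <= cpos i x /\ cpos i j + cpos j x = cpos i x \/
  cpos i x < cpos i j /\ cpos i j + cpos j x = cpos i x + n.
Proof. by have := cpos_trans i j x; case: ltnP => h e; [right|left]; lia. Qed.

Lemma in_setand S (P : pred 'I_n) x : (x \in [set y in S | P y]) = (x \in S) && P x.
Proof. by rewrite in_set. Qed.

Lemma wexc_mono s i j x :
  cpos i j <= cpos i x -> x \in wexc s i -> x \in wexc s j.
Proof.
rewrite !inE /clt => h /orP[->//|hx]; apply/orP; right.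
have := cposD i j x; have := cposD i j (dfun s x).
by lia.
Qed.

Lemma card_wexc s i : #|wexc s i| = num_wexc s.
Proof.
have cardW j : n * #|wexc s j| + \sum_x cpos x (dfun s x) =
    n * #|[set x | (x \in over s) || (dfun s x != x)]|.
  rewrite -!sum1_card !big_distrr /= !(big_mkcond (fun x => x \in _)) /=.
  have e : \sum_x cpos j (dfun s x) = \sum_x cpos j x.
    rewrite [RHS](reindex_inj (@perm_inj _ (dfun s))); exact: eq_bigr.
  apply: (@addIn (\sum_x cpos j x)); rewrite -addnA -[X in _ = _ + X]e.
  rewrite -!big_split /=; apply: eq_bigr => x _.
  rewrite [_ + cpos j x]addnC cpos_trans !inE /clt.
  case: (boolP (x \in over s)) => [xo|_] /=.
    by have /forall_inP/(_ _ xo)/eqP-> := over_fixed s; rewrite ltnn; lia.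
  case: (eqVneq (dfun s x) x) => [->|ne] /=; first by rewrite ltnn addn0.
  have : cpos j (dfun s x) != cpos j x.
    by apply: contra ne => /eqP/cpos_inj->.
  by case: ltngtP => //= _ _; lia.
have n0 : 0 < n by apply: leq_ltn_trans (ltn_ord i).
have -> : num_wexc s = #|wexc s (Ordinal n0)|.
  by apply: eq_card => x; rewrite !inE /clt !cposE /= !subn0.
by apply/eqP; rewrite -(eqn_pmul2l n0) -(eqn_add2r (\sum_x cpos x (dfun s x))) !cardW.
Qed.

Lemma all2_count (a b : seq nat) : sorted leq a -> sorted leq b ->
  size a = size b ->
  all2 leq a b <-> forall m, count (ltn^~ m) b <= count (ltn^~ m) a.
Proof.
elim: a b => [|x a IH] [|y b] //=.
rewrite !(path_sortedE leq_trans) => /andP[xa sa] /andP[yb sb] [sz].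
have {}IH := IH _ sa sb sz; split=> [/andP[xy /IH h] m|h].
  by apply: leq_add (h m); case: (ltnP y m) => // ym; lia.
have xy : x <= y.
  have := h y.+1; rewrite leqnn /= ltnS; case: (leqP x y) => // yx.
  suff -> : count (ltn^~ y.+1) a = 0 by lia.
  apply/eqP; rewrite eqn0Ngt -has_count; apply/hasPn => z /(allP xa) /= xz; lia.
rewrite xy /=; apply/IH => m; have := h m.
case: (ltnP y m) => /= ym; first by rewrite (leq_ltn_trans xy ym) leq_add2l.
suff -> : count (ltn^~ m) b = 0 by [].
apply/eqP; rewrite eqn0Ngt -has_count; apply/hasPn => z /(allP yb) /= yz; lia.
Qed.

Lemma gale_leP i S T : #|S| = #|T| ->
  gale_le i S T <->
  forall m, #|[set x in T | cpos i x < m]| <= #|[set x in S | cpos i x < m]|.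
Proof.
move=> ST; set f := fun S : {set 'I_n} => map (cpos i) (sort (cle i) (enum S)).
have fE (R : {set 'I_n}) m : #|[set x in R | cpos i x < m]| = count (ltn^~ m) (f R).
  rewrite count_map count_sort -size_filter cardE; apply/perm_size/uniq_perm.
  - exact: enum_uniq.
  - exact/filter_uniq/enum_uniq.
  - by move=> x; rewrite mem_enum mem_filter mem_enum inE andbC.
have srt (R : {set 'I_n}) : sorted leq (f R).
  rewrite /f sorted_map; apply: sort_sorted => a b; exact: leq_total.
have -> : gale_le i S T = all2 leq (f S) (f T).
  rewrite /gale_le /f; move: (sort _ _) (sort _ _) => u v.
  by elim: u v => [|a u IH] [|b v] //=; rewrite IH.
rewrite (all2_count (srt S) (srt T)); first by split=> h m; have := h m; rewrite !fE.
by rewrite !size_map !size_sort -!cardE.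
Qed.

Lemma positroid_neq0 s : positroid_bases s != set0.
Proof.
apply/set0Pn.
case: (posnP n) => [n0|n0].
  exists [set j | (j \in over s) || (j < dfun s j)]; rewrite inE eqxx /=.
  by apply/forallP => i; exfalso; have := ltn_ord i; lia.
set i := Ordinal n0; exists (wexc s i); rewrite inE card_wexc eqxx /=.
apply/forallP => j; apply/gale_leP; first by rewrite !card_wexc.
move=> m; case: (leqP m (cpos j i)) => [mi|im].
  apply/subset_leq_card/subsetP => x; rewrite !in_setand => /andP[xW xm].
  rewrite xm andbT; move: xW; apply: wexc_mono.
  by have := cposD i j x; have := cposD j i x;
    have := cpos_lt i j; have := cpos_lt j i; lia.
have split_m k : #|[set x in wexc s k | cpos j x < m]| +
    #|[set x in wexc s k | m <= cpos j x]| = num_wexc s.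
  rewrite -(card_wexc s k) -(cardsID [set x | cpos j x < m] (wexc s k)).
  congr (_ + _); apply: eq_card => x; rewrite !in_set //.
  by rewrite -leqNgt andbC.
rewrite -(leq_add2r #|[set x in wexc s j | m <= cpos j x]|) split_m.
rewrite -[leqRHS](split_m i) leq_add2l.
apply/subset_leq_card/subsetP => x; rewrite !in_setand => /andP[xW xm].
rewrite xm andbT; move: xW; apply: wexc_mono; lia.
Qed.

(** Submodular covering argument behind the exchange property: [B1], [B2] obey
    the bounds [r a b] on all intervals [a, b), and each element of B2 \ B1
    below [N] lies in an interval on which [B1] attains its bound. *)
Lemma tight_cover (c : 'I_n -> nat) (r : nat -> nat -> nat) (B1 B2 : {set 'I_n}) N
    (ivc := fun S a b => #|[set x in S | a <= c x < b]|) :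
  (forall a c b d, a <= c -> c <= b -> b <= d -> d <= N ->
     r a d + r c b <= r a b + r c d) ->
  (forall a b, a <= b -> b <= N -> ivc B1 a b <= r a b) ->
  (forall a b, a <= b -> b <= N -> ivc B2 a b <= r a b) ->
  (forall y, y \in B2 :\: B1 -> c y < N ->
     exists a b, [/\ a <= c y < b, b <= N & ivc B1 a b = r a b]) ->
  ivc B2 0 N <= ivc B1 0 N.
Proof.
move=> submod le1 le2 cov.
have ivcD (S : {set 'I_n}) a b d : a <= b -> b <= d -> ivc S a d = ivc S a b + ivc S b d.
  move=> ab bd; rewrite /ivc -(cardsID [set x | c x < b] [set x in S | _]).
  congr (_ + _); apply: eq_card => x; rewrite !inE;
    case: (x \in S) => //=; lia.
suff H p : p <= N ->
   (forall y, y \in B2 :\: B1 -> c y < p ->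
     exists a b, [/\ a <= c y < b, b <= p & ivc B1 a b = r a b]) ->
   ivc B2 0 p <= ivc B1 0 p by apply: H.
elim/ltn_ind: p => p IH pN {}cov.
have [/existsP[[a ap] /= /eqP tight]|none] :=
  boolP [exists a : 'I_p, ivc B1 a p == r a p].
- have ex : exists a, (a < p) && (ivc B1 a p == r a p).
    by exists a; rewrite ap tight eqxx.
  case: (ex_minnP ex) => {ap tight}a /andP[ap /eqP tight] amin.
  have apW := ltnW ap.
  rewrite !(ivcD _ _ _ _ (leq0n a) apW); apply: leq_add; last first.
    by rewrite tight; apply: le2.
  apply: IH => // [|y yD ya]; first exact: leq_trans apW pN.
  have [u [v [/andP[uy yv] vp tuv]]] := cov y yD (ltn_trans ya ap).
  exists u, v; split=> //; first by rewrite uy.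
  rewrite leqNgt; apply/negP => av.
  have ua : u < a by lia.
  have := submod u a v p (ltnW ua) (ltnW av) vp pN.
  have := le1 u p _ pN; have := le1 a v (ltnW av) (leq_trans vp pN).
  have := ivcD B1 u a p (ltnW ua) apW; have := ivcD B1 u a v (ltnW ua) (ltnW av).
  move=> e1 e2 l1 l2 l3.
  have up : u < p by lia.
  have tup : ivc B1 u p = r u p by have := l2 (ltnW up); lia.
  by have := amin u; rewrite up tup eqxx leqNgt ua => /(_ isT).
- case: p => [|p] in IH pN cov none *.
    by rewrite /ivc [X in #|pred_of_set X| <= _](_ : _ = set0) ?cards0 //;
      apply/setP => x; rewrite !inE ltn0 !andbF.
  have last a b y : a <= c y < b -> b <= p.+1 -> ivc B1 a b = r a b -> b <= p.
    move=> /andP[ay yb] bp t; rewrite -ltnS ltn_neqAle bp andbT.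
    apply/eqP => eb; move/existsPn: none; rewrite eb in t yb.
    by move/(_ (Ordinal (leq_ltn_trans ay yb))); rewrite /= t eqxx.
  rewrite !(ivcD _ 0 p p.+1) //; apply: leq_add.
    apply: IH => // [|y yD yp]; first exact: ltnW.
    have [a [b [h1 h2 h3]]] := cov y yD (ltnW yp).
    by exists a, b; split=> //; apply: last h1 h2 h3.
  apply/subset_leq_card/subsetP => x; rewrite !in_set => /andP[x2 xp].
  rewrite xp andbT; apply/negPn/negP => x1.
  have xD : x \in B2 :\: B1 by rewrite in_setD x1.
  have [a [b [h1 h2 h3]]] := cov x xD (proj2 (andP xp)).
  by have := last _ _ _ h1 h2 h3; lia.
Qed.

Lemma positroid_exchange s B1 B2 e :
  B1 \in positroid_bases s -> B2 \in positroid_bases s -> e \in B1 :\: B2 ->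
  exists2 y, y \in B2 :\: B1 & y |: (B1 :\ e) \in positroid_bases s.
Proof.
move=> b1 b2 /[!inE] /andP[e2 e1].
have n0 : 0 < n by apply: leq_ltn_trans (ltn_ord e).
have baseP (B : {set 'I_n}) : B \in positroid_bases s <-> #|B| = num_wexc s /\
    forall i m, #|[set x in B | cpos i x < m]| <= #|[set x in wexc s i | cpos i x < m]|.
  rewrite inE; split=> [/andP[/eqP cB /forallP h]|[cB h]].
    by split=> // i; apply/gale_leP; rewrite ?card_wexc.
  rewrite cB eqxx /=; apply/forallP => i; apply/gale_leP; last exact: h.
  by rewrite card_wexc.
have [/exists_inP[y yD yB]|none] :=
  boolP [exists y in B2 :\: B1, y |: (B1 :\ e) \in positroid_bases s].
  by exists y.
exfalso; have [c1 h1] := (baseP B1).1 b1; have [c2 h2] := (baseP B2).1 b2.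
set z := ordS e; pose c := cpos z.
have ce : c e = n.-1.
  have he := ltn_ord e; rewrite /c cposE /=; case: (ltnP e.+1 n) => h.
    by rewrite modn_small //; case: leqP; lia.
  have -> : e.+1 = n by lia.
  by rewrite modnn; case: leqP; lia.
pose elt a : 'I_n := Ordinal (ltn_pmod (z + a) n0).
have eltE a : a < n -> c (elt a) = a.
  move=> an; rewrite /c /cpos /= modnDml -addnA addnC.
  have -> : a + (n - z) + z = n + a by have := ltn_ord z; lia.
  by rewrite modnDl modn_small.
have eltK x : elt (c x) = x.
  by apply: (@cpos_inj z); rewrite -/(c _) eltE ?cpos_lt.
pose r a b := #|[set x in wexc s (elt a) | a <= c x < b]|.
have pre i m x : m <= n - c i ->
    (cpos i x < m) = (c i <= c x < c i + m).
  move=> hm; have := cposD z i x; rewrite -/(c i) -/(c x).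
  by have := cpos_lt z x; rewrite -/(c x); have := cpos_lt i x; lia.
have preS (S : {set 'I_n}) a b : a < n -> a <= b -> b <= n ->
    [set x in S | a <= c x < b] = [set x in S | cpos (elt a) x < b - a].
  move=> an ab bn; apply/setP => x; rewrite !inE pre eltE //; last by lia.
  by rewrite subnKC.
have bound (B : {set 'I_n}) : (forall i m, #|[set x in B | cpos i x < m]| <=
      #|[set x in wexc s i | cpos i x < m]|) ->
    forall a b, a <= b -> b <= n.-1 -> #|[set x in B | a <= c x < b]| <= r a b.
  move=> h a b ab bn; rewrite /r !preS; try lia; exact: h.
have ivcD (S : {set 'I_n}) a b d : a <= b -> b <= d ->
  #|[set x in S | a <= c x < d]| =
  #|[set x in S | a <= c x < b]| + #|[set x in S | b <= c x < d]|.
  move=> ab bd; rewrite -(cardsID [set x | c x < b] [set x in S | _ <= _ < d]).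
  congr (_ + _); apply: eq_card => x; rewrite !in_set;
    case: (x \in S) => //=; lia.
have cn x : (0 <= c x < n.-1) = (x != e).
  have := cpos_lt z x; rewrite -/(c x) => xn.
  case: (eqVneq x e) => [->|xe]; first by rewrite ce ltnn.
  have : c x != c e by apply: contra xe => /eqP/cpos_inj->.
  by rewrite ce; lia.
have sD1 (S : {set 'I_n}) : [set x in S | 0 <= c x < n.-1] = S :\ e.
  by apply/setP => x; rewrite in_set cn in_setD1 andbC.
suff : #|B2 :\ e| <= #|B1 :\ e|.
  have := cardsD1 e B1; have := cardsD1 e B2.
  by rewrite c1 c2 e1 (negbTE e2); lia.
rewrite -!sD1; apply: (@tight_cover c r); [|exact: bound|exact: bound|].
  move=> a k b d ak kb bd dn; rewrite /r.
  have -> := ivcD (wexc s (elt a)) _ _ _ (leq_trans ak kb) bd.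
  have -> := ivcD (wexc s (elt k)) _ _ _ kb bd.
  rewrite -[leqLHS]addnA leq_add2l [leqLHS]addnC leq_add2l.
  apply/subset_leq_card/subsetP => x; rewrite !in_setand => /andP[xW xm].
  rewrite xm andbT; move: xW; apply: wexc_mono.
  have := cposD z (elt a) (elt k); have := cposD z (elt a) x.
  by rewrite -/(c _) -/(c x) -/(c (elt k)) !eltE; lia.
move=> y yD; rewrite ltnNge => yn.
have [/existsP[i /existsP[m /and3P[ym mn /eqP tight]]]|nt] :=
  boolP [exists i, [exists m : 'I_n, [&& cpos i y < m, c i + m <= n.-1 &
    #|[set x in B1 | cpos i x < m]| == #|[set x in wexc s i | cpos i x < m]|]]].
  have cin : c i < n by apply: cpos_lt.
  exists (c i), (c i + m); split=> //; first by rewrite -pre //; lia.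
  by rewrite /r !preS ?eltK ?addKn //; lia.
exfalso; move/exists_inPn: none => /(_ y yD)/negP; apply; apply/baseP.
have [yB2 yB1] : y \in B2 /\ y \notin B1 by move: yD; rewrite in_setD => /andP[].
split; first by rewrite cardsU1 !inE negb_and yB1 orbT -c1 (cardsD1 e B1) e1.
move=> i m; set B' := _ |: _.
have [ym|ym] := ltnP (cpos i y) m; last first.
  apply: leq_trans (h1 i m); apply/subset_leq_card/subsetP => x.
  rewrite !inE => /andP[/orP[/eqP->|/andP[_ ->]] //]; first by rewrite ltnNge ym.
have [em|em] := ltnP (cpos i e) m.
  apply: leq_trans (h1 i m); rewrite (cardsD1 e [set x in B1 | _]) inE e1 em /=.
  apply: (@leq_trans #|y |: ([set x in B1 | cpos i x < m] :\ e)|); last first.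
    by rewrite cardsU1 leq_add2r leq_b1.
  apply/subset_leq_card/subsetP => x; rewrite !inE.
  by case: (x == y) => //=; case: (x == e) => //=.
apply: (@leq_trans #|y |: [set x in B1 | cpos i x < m]|).
  apply/subset_leq_card/subsetP => x; rewrite !inE.
  by case: (x == y) => //=; case: (x == e) => //=.
rewrite cardsU1 inE (negbTE yB1) /= add1n ltn_neqAle h1 andbT.
apply/negP => tight.
have mn : m < n by apply: leq_ltn_trans em (cpos_lt _ _).
move/existsPn: nt => /(_ i)/existsPn/(_ (Ordinal mn)); rewrite /= ym tight andbT /=.
have := cposD z i e; rewrite -/(c i) -/(c e) ce.
by have := cpos_lt z i; rewrite -/(c i); lia.
Qed.

End CyclicOrder.

Definition positroid n (s : dperm n) : matroid 'I_n :=
  Matroid (positroid_neq0 s) (@positroid_exchange n s).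

(** The relation between D_{k-1,n} and D_{k,n}, for all k at once: the first
    conjunct says that t and p belong to these sets for a common k. *)
Definition lessdot n (t p : dperm n) : Prop :=
  num_wexc p = (num_wexc t).+1 /\ quotient_of (positroid t) (positroid p).

Section UniformPerm.
Variables n k : nat.

Definition unif_fun (i : 'I_n) : 'I_n :=
  Ordinal (ltn_pmod (i + (n - k)) (leq_ltn_trans (leq0n i) (ltn_ord i))).

Lemma unif_fun_inj : injective unif_fun.
Proof.
move=> i j /(congr1 val) /= /eqP; rewrite eqn_modDr !modn_small // => /eqP.
exact: val_inj.
Qed.

Definition unif_perm : {perm 'I_n} := perm unif_fun_inj.

(** The map i |-> i + (n - k) has fixed points only for k = 0 (all underlined)
    and k = n (all overlined). *)
Definition unif_over : {set 'I_n} :=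
  if k == 0 then set0 else [set i | unif_perm i == i].

Lemma unif_over_fixed : [forall i in unif_over, unif_perm i == i].
Proof. by apply/forall_inP => i; rewrite /unif_over; case: ifP; rewrite inE. Qed.

Definition unif_dperm : dperm n := DPerm unif_over_fixed.

End UniformPerm.

Section Shift.
Variables (n : nat) (A : {set 'I_n}) (s : dperm n).

(** Positions whose value is not frozen, in increasing order. *)
Definition unfrozen : seq 'I_n := enum [set j | dfun s j \notin A].

(** [next c] sends an entry of the duplicate-free sequence [c] to the cyclically
    following one and fixes everything outside of [c]. *)
Definition shift_fun (j : 'I_n) : 'I_n := dfun s (next unfrozen j).

Lemma shift_fun_inj : injective shift_fun.
Proof. exact: inj_comp perm_inj (can_inj (prev_next (enum_uniq _))). Qed.

Definition shift_perm : {perm 'I_n} := perm shift_fun_inj.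

(** A fixed point is overlined after the shift exactly when it was overlined
    and is frozen; fixed points at unfrozen positions become underlined. *)
Definition shift_over : {set 'I_n} := [set j in over s | dfun s j \in A].

Lemma shift_over_fixed : [forall j in shift_over, shift_perm j == j].
Proof.
apply/forall_inP => j; rewrite inE permE /shift_fun => /andP[jo jA].
have -> : next unfrozen j = j.
  have : j \notin unfrozen by rewrite mem_enum inE jA.
  have H p (y z : 'I_n) : j \notin z :: p -> next_at j y z p = j.
    elim: p z => [|t p IH] z; rewrite in_cons negb_or => /andP[/negbTE /= -> //].
    exact: IH.
  by rewrite /next; case: unfrozen => // y p; apply: H.
by have /forall_inP/(_ _ jo) := over_fixed s.
Qed.

Definition shift : dperm n := DPerm shift_over_fixed.

End Shift.

(* Main.v *)
(** Write F for the set of positions of frozen values, so that #|F| < k. For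
    every i, the set W_i(sigma) contains [i, i+k) minus the last unfrozen position
    p_i of [i, i+k); hence a (k-1)-set is a basis of P_sigma as soon as it contains
    no arc [i, p_i]. It suffices that every k-set D contains a basis, i.e. that
    the arcs [i, p_i] contained in D have a common element. For each value p
    of p_i keep only the shortest such arc: its complement in D has as many
    elements as the frozen run (p, i+k) following p. These runs are disjoint
    for distinct p, so the complements cover at most #|F| < k elements of D. *)

Require Import Defs.
From mathcomp Require Import all_boot all_fingroup.
From mathcomp Require Import zify.

Set Implicit Arguments.
Unset Strict Implicit.
Unset Printing Implicit Defensive.

(** * Subsets of given size and quotients of a uniform matroid *)

Lemma exists_subset_card (T : finType) (C : {set T}) k :
  k <= #|C| -> exists2 B : {set T}, B \subset C & #|B| = k.
Proof.
move=> kC; exists [set x in take k (enum C)].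
  by apply/subsetP => x; rewrite inE => /mem_take; rewrite mem_enum.
rewrite cardsE (card_uniqP _) ?take_uniq ?enum_uniq //.
by rewrite size_takel // -cardE.
Qed.

Lemma exists_superset_card (T : finType) (C : {set T}) k :
  #|C| <= k <= #|T| -> exists2 B : {set T}, C \subset B & #|B| = k.
Proof.
move=> /andP[Ck kT]; have [|B BC cB] := @exists_subset_card T (~: C) (#|T| - k).
  by have := cardsC C; lia.
exists (~: B); first by rewrite -setCS setCK.
by have := cardsC B; lia.
Qed.

Lemma card_bigcup_leq (I T : finType) (P : pred I) (F : I -> {set T}) :
  #|\bigcup_(i | P i) F i| <= \sum_(i | P i) #|F i|.
Proof.
elim/big_rec2: _ => [|i m X _ h]; first by rewrite cards0.
by apply: leq_trans (leq_card_setU _ _) _; rewrite leq_add2l.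
Qed.

(** A circuit [C] of [N] has more than [k] elements, so for each [e] in [C] some basis [B] of [M]
    lies in [C :\ e]. Then [e |: B] is too large to be independent in [M], and a circuit inside it
    must contain [e], since subsets of [B] are independent. *)
Lemma quotient_of_uniform (T : finType) (M N : matroid T) k :
  k <= #|T| -> bases N = [set B : {set T} | #|B| == k] ->
  (forall B : {set T}, B \in bases M -> #|B|.+1 = k) ->
  (forall D : {set T}, #|D| = k -> exists2 B : {set T}, B \in bases M & B \subset D) ->
  quotient_of M N.
Proof.
move=> kT NE cM span C /minsetp dC.
have kC : k < #|C|.
  rewrite ltnNge; apply: contra dC => Ck.
  have [|B CB cB] := @exists_superset_card _ C k; first by rewrite Ck.
  by apply/exists_inP; exists B; rewrite // NE inE cB.
exists [set D | circuit M D & D \subset C] => [D|]; first by rewrite inE => /andP[].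
apply/eqP; rewrite eqEsubset andbC; apply/andP; split.
  by apply/bigcupsP => D; rewrite inE => /andP[].
apply/subsetP => e eC.
have [|D DC cD] := @exists_subset_card _ (C :\ e) k.
  by have := cardsD1 e C; rewrite eC; lia.
have [B BM BD] := span D cD.
have BCe := subset_trans BD DC.
have eB : e \notin B by apply/negP => /(subsetP BCe); rewrite !inE eqxx.
have [|X mX XB] := @minset_exists _ (fun X => ~~ indep M X) (e |: B).
  apply/exists_inP => -[B' B'M /subset_leq_card].
  by rewrite cardsU1 eB; have := cM _ BM; have := cM _ B'M; lia.
apply/bigcupP; exists X.
  rewrite inE /circuit mX; apply: subset_trans XB _.
  rewrite subUset sub1set eC; apply: subset_trans BCe _; exact: subD1set.
have := minsetp mX; apply: contraR => eX; apply/exists_inP; exists B => //.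
apply/subsetP => x xX; have := subsetP XB x xX; rewrite !inE.
by case/orP => // /eqP xe; rewrite -xe xX in eX.
Qed.

(** * Cyclic successors in a sorted list *)

Lemma clt_cpos_next n (c : seq 'I_n) (j p : 'I_n) :
  sorted (fun a b : 'I_n => a < b) c -> j \in c -> p \in c -> p != j ->
  0 < cpos j (next c j) <= cpos j p.
Proof.
move=> srt jc pc pj.
have tr : transitive (fun a b : 'I_n => a < b) by move=> y x z; apply: ltn_trans.
have uc : uniq c by apply: sorted_uniq srt => // x; apply: ltnn.
move: srt uc pc; case/splitPr: jc => c1 c2; rewrite sorted_pairwise // pairwise_cat /=.
case/and3P=> /allrelP h1 pw1 /andP[/allP h2 pw2] uc.
(* Rotating [j] to the front makes its successor the second entry: the head of [c2], or that of [c1]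
   when [j] is the last entry. *)
rewrite -(next_rot (size c1) uc) rot_size_cat mem_cat in_cons (negbTE pj) /=.
have cposP (y : 'I_n) : j <= y /\ cpos j y = y - j \/ y < j /\ cpos j y = y + n - j.
  by rewrite cposE; case: leqP; [left|right].
have hj := ltn_ord j; have hp := ltn_ord p.
case: c2 => [|x c2] /= in h1 h2 pw2 {uc} *.
  case: c1 => [|x c1] //= in h1 pw1 *; rewrite eqxx orbF => pc.
  have hx := ltn_ord x.
  have := h1 x j (mem_head _ _) (mem_head _ _); have := h1 p j pc (mem_head _ _).
  move: pc; rewrite inE; case: eqP => [->|_ /= pc]; first by move: (cposP p) (cposP x); lia.
  by have /andP[/allP/(_ p pc)] := pw1; move: (cposP p) (cposP x); lia.
rewrite eqxx; have := h2 x (mem_head _ _); have hx := ltn_ord x.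
move=> jx /orP[pc|].
  by have := h1 p j pc (mem_head _ _); move: (cposP p) (cposP x); lia.
rewrite inE => /orP[/eqP->|pc]; first by move: (cposP p) (cposP x); lia.
by have /andP[/allP/(_ p pc)] := pw2; move: (cposP p) (cposP x); lia.
Qed.

Lemma sorted_enum_ord n (S : {set 'I_n}) :
  sorted (fun a b : 'I_n => a < b) (enum S).
Proof.
have tr : transitive (fun a b : 'I_n => a < b) by move=> y x z; apply: ltn_trans.
rewrite /(enum _) /enum_mem; apply: sorted_filter => //; rewrite -enumT.
by have := iota_ltn_sorted 0 n; rewrite -val_enum_ord sorted_map.
Qed.

(** * Last unfrozen positions of cyclic intervals; [U] stands for the set of positions of unfrozen
    values *)

Section LastInWindow.
Variables (n k : nat) (U : {set 'I_n}).
Hypotheses (kn : k <= n) (cU : #|~: U| < k).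
Implicit Types (i p x : 'I_n) (B D : {set 'I_n}).

Definition window i m : {set 'I_n} := [set x | cpos i x < m].
Definition arc i p : {set 'I_n} := [set x | cpos i x <= cpos i p].
Definition is_last i p :=
  [&& p \in U, cpos i p < k & [forall x in U, (cpos i x < k) ==> (cpos i x <= cpos i p)]].

Lemma card_window i m : m <= n -> #|window i m| = m.
Proof.
move=> mn; pose f x : 'I_n := Ordinal (cpos_lt i x).
have fi : injective f by move=> x y /(congr1 val) /= /cpos_inj.
have -> : window i m = f @^-1: [set widen_ord mn j | j : 'I_m].
  apply/setP => x; rewrite !inE; apply/idP/imsetP => [xm|[j _ /(congr1 val) /= ->]] //.
  by exists (Ordinal xm) => //; apply: val_inj.
rewrite card_preimset // card_imset ?card_ord // => a b /(congr1 val) /= e.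
exact: val_inj.
Qed.

Lemma exists_last i : exists p, is_last i p.
Proof.
have /set0Pn[x] : window i k :&: U != set0.
  apply/negP => /eqP e; have : window i k \subset ~: U by rewrite -disjoints_subset -setI_eq0 e.
  by move/subset_leq_card; rewrite card_window //; lia.
rewrite !inE => xP.
case: (@arg_maxnP _ x (fun x => (cpos i x < k) && (x \in U)) (cpos i) xP) => p /andP[pk pU] pm.
exists p; rewrite /is_last pU pk /=; apply/forall_inP => y yU; apply/implyP => yk.
by apply: pm; rewrite yk yU.
Qed.

Lemma is_last_le i p x : is_last i p -> x \in U -> cpos i x < k -> cpos i x <= cpos i p.
Proof. by case/and3P => _ _ /forall_inP h xU xk; move/implyP: (h x xU); apply. Qed.

Lemma exists_common_element D : #|D| = k ->
  exists2 y, y \in D & forall i p, is_last i p -> arc i p \subset D -> y \in arc i p.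
Proof.
move=> cD; have [p0 p0U] : exists p, p \in U.
  apply/set0Pn/negP => /eqP U0; have := cardsC U; rewrite U0 cards0 card_ord; move: cU; rewrite U0; lia.
(* The element of [U] nearest to [x] when going backwards from [x], with [x] itself allowed. *)
pose prevu x := [arg min_(p < p0 in U) cpos p x].
pose bad p i := is_last i p && (arc i p \subset D).
pose cut p := \bigcup_(i | bad p i) (D :\: arc i p).
(* The fibres of [prevu] partition [~: U], so these bounds add up to [#|~: U| < k]. *)
have cutP p : #|cut p| <= \sum_(x in ~: U | prevu x == p) 1.
  have [/existsP[i1 bi1]|/existsPn none] := boolP [exists i, bad p i]; last first.
    by rewrite /cut big_pred0 ?cards0 // => i; apply/negbTE.
  case: (arg_minnP (fun i => cpos i p) bi1) => i /andP[li iD] imin.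
  have pk : cpos i p < k by case/and3P: li.
  have pU : p \in U by case/and3P: li.
  (* Arcs ending at [p] are nested, so the shortest one has the largest complement. *)
  have sub : cut p \subset D :\: arc i p.
    apply/bigcupsP => j bj; apply: setDS; apply/subsetP => x; rewrite !inE.
    have := imin j bj; have := cposD i x p; have := cposD j x p.
    by have := cpos_lt x p; have := cpos_lt i p; have := cpos_lt j p;
      have := cpos_lt j x; have := cpos_lt i x; lia.
  apply: leq_trans (subset_leq_card sub) _.
  have aw : arc i p \subset window i k by apply/subsetP => x; rewrite !inE; lia.
  (* [D] and the window both have [k] elements and both contain the arc. *)
  have -> : #|D :\: arc i p| = #|window i k :\: arc i p|.
    by rewrite !cardsD (setIidPr iD) (setIidPr aw) cD card_window.
  rewrite sum1_card; apply/subset_leq_card/subsetP => x; rewrite !inE -ltnNge unfold_in => /andP[px xk].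
  have xU : x \notin U.
    by apply/negP => xU; have := is_last_le li xU xk; lia.
  (* The minimiser [q] lies between [p] and [x], hence in the window, where [p] is the last element
     of [U]; so [q] is [p]. *)
  rewrite inE xU /= /prevu; case: arg_minnP => // q qU qmin.
  have := qmin p pU; have := @is_last_le _ _ q li qU.
  have := cposD i q x; have := cposD i p x.
  have := cpos_lt q x; have := cpos_lt p x; have := cpos_lt i q; move=> h1 h2 h3 h4 h5 h6 h7.
  apply/eqP; apply: (@cpos_inj _ i); lia.
have /subsetPn[y yD yc] : ~~ (D \subset \bigcup_p cut p).
  apply/negP => /subset_leq_card; rewrite cD leqNgt => /negP; apply.
  apply: leq_ltn_trans cU; apply: leq_trans (card_bigcup_leq _ _) _.
  rewrite -[leqRHS]sum1_card [leqRHS](partition_big prevu xpredT) //=.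
  by apply: leq_sum => p _; exact: cutP.
exists y => // i p li aD; apply: contraR yc => ya; apply/bigcupP; exists p => //.
by apply/bigcupP; exists i; rewrite ?in_setD ?ya // /bad li aD.
Qed.

(** Removing from [D] an element common to all arcs [arc i p] inside [D], with [p] last for [i],
    leaves a set containing none of these arcs. *)
Lemma exists_basis_in (s : dperm n) : (num_wexc s).+1 = k ->
  (forall i p, is_last i p -> window i k :\ p \subset wexc s i) ->
  forall D, #|D| = k -> exists2 B : {set 'I_n}, B \in positroid_bases s & B \subset D.
Proof.
move=> rs Ws D cD; have [y yD yP] := exists_common_element cD.
exists (D :\ y); last exact: subD1set.
have cB : #|D :\ y| = num_wexc s by have := cardsD1 y D; rewrite yD; lia.
suff gi (i : 'I_n) : gale_le i (wexc s i) (D :\ y).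
  by rewrite inE cB eqxx; apply/forallP.
apply/gale_leP; rewrite ?card_wexc // => m.
have [p lp] := exists_last i; have pk : cpos i p < k by case/and3P: lp.
(* From [k] on, total sizes suffice: both sides are compared with [k - 1]. *)
have [km|mk] := leqP k m.
  apply: (@leq_trans #|window i k :\ p|).
    apply: (@leq_trans #|D :\ y|).
      by apply/subset_leq_card/subsetP => x; rewrite in_setand => /andP[].
    rewrite cB.
    have := cardsD1 p (window i k); rewrite inE pk card_window // add1n => e.
    by rewrite -ltnS rs {1}e.
  apply/subset_leq_card/subsetP => x xw; rewrite in_setand (subsetP (Ws i p lp)) //=.
  by move: xw; rewrite !inE; lia.
have Wm : window i m :\ p \subset [set x in wexc s i | cpos i x < m].
  apply/subsetP => x xw; rewrite in_setand.
  move: xw; rewrite !inE => /andP[xp xm]; rewrite xm andbT.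
  by have := subsetP (Ws i p lp) x; rewrite !inE xp /=; apply; lia.
apply: leq_trans (subset_leq_card Wm); have := cardsD1 p (window i m); rewrite inE.
(* If [p] is among the first [m] positions, only [m - 1] of them are known to lie in [wexc s i]. But
   [D :\ y] cannot contain all [m]: it would contain [arc i p], and with it [y]. *)
case: ltnP => /= pm e.
  rewrite add1n in e; rewrite -ltnS -e; apply: proper_card; rewrite properE.
  apply/andP; split; first by apply/subsetP => x; rewrite !inE => /andP[].
  apply/negP => wB.
  have aD : arc i p \subset D :\ y.
    apply/subsetP => x xa; have : x \in window i m by move: xa; rewrite !inE; lia.
    by move/(subsetP wB); rewrite in_setand => /andP[].
  have := subsetP aD y (yP i p lp (subset_trans aD (subD1set _ _))).
  by rewrite !inE eqxx.
rewrite add0n in e; rewrite -e; apply/subset_leq_card/subsetP => x.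
by rewrite !inE => /andP[].
Qed.

End LastInWindow.

(** * Weak excedances of the uniform permutation and of its shift *)

Lemma cpos_unif_perm n k (i j : 'I_n) :
  k <= n -> cpos i j < k -> cpos i (unif_perm n k j) = cpos i j + (n - k).
Proof.
move=> kn jk.
have -> : cpos i (unif_perm n k j) = (cpos i j + (n - k)) %% n.
  by rewrite /cpos permE /= modnDml modnDml addnAC.
by rewrite modn_small //; lia.
Qed.

(** For [k < n], each position of the window moves forward by [n - k] without passing [i] again; for
    [k = n], all positions are overlined fixed points. *)
Lemma window_sub_wexc_unif n k (i : 'I_n) :
  0 < k <= n -> window i k \subset wexc (unif_dperm n k) i.
Proof.
case/andP=> k0 kn; apply/subsetP => j; rewrite !inE /= /clt => jk.
rewrite cpos_unif_perm // /unif_over; case: eqP => [|_]; first by lia.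
have [e|] := eqVneq k n; last by lia.
rewrite inE; apply/orP; left; apply/eqP/(@cpos_inj _ i).
by rewrite cpos_unif_perm //; lia.
Qed.

Lemma num_wexc_unif n k : 0 < k <= n -> num_wexc (unif_dperm n k) = k.
Proof.
move=> /[dup] kn /andP[k0 kn'].
have n0 : 0 < n by lia.
pose i := Ordinal n0; rewrite -(card_wexc _ i) -[RHS](card_window i kn').
apply: eq_card; apply/subset_eqP; rewrite window_sub_wexc_unif // andbT.
apply/subsetP => j; rewrite !inE /clt /= /unif_over.
have [|_] := eqVneq k 0; first by lia.
have jn := cpos_lt i j; have hj := ltn_ord j; case: (eqVneq k n) => [e|ne]; first by rewrite e.
rewrite inE !cposE /= permE /= !subn0; case: (ltnP j k) => // kj.
have -> : (j + (n - k)) %% n = j - k.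
  by rewrite (_ : j + (n - k) = n + (j - k)) ?modnDl ?modn_small; lia.
rewrite ltnNge leq_subr orbF => /eqP /(congr1 val) /=.
rewrite (_ : j + (n - k) = n + (j - k)) ?modnDl ?modn_small; lia.
Qed.

(** The window of length [k] at [i] is the least [k]-set for the Gale order at [i], and it lies in
    the set of weak [i]-excedances. *)
Lemma positroid_bases_unif n k :
  0 < k <= n -> positroid_bases (unif_dperm n k) = [set B : {set 'I_n} | #|B| == k].
Proof.
move=> /[dup] kn /andP[_ kn']; apply/setP => B; rewrite !inE num_wexc_unif //.
case: eqP => // cB; apply/forallP => i; apply/gale_leP.
  by rewrite card_wexc num_wexc_unif.
move=> m; have [km|mk] := leqP k m.
  apply: leq_trans (subset_leq_card (_ : window i k \subset _)).
    by rewrite card_window // -cB; apply/subset_leq_card/subsetP => x; rewrite inE => /andP[].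
  apply/subsetP => x xw; rewrite in_setand (subsetP (window_sub_wexc_unif i kn)) //=.
  by move: xw; rewrite inE; lia.
apply: (@leq_trans #|window i m|).
  by apply/subset_leq_card/subsetP => x; rewrite !inE => /andP[].
apply/subset_leq_card/subsetP => x xw; rewrite in_setand.
move: xw; rewrite inE => xm; rewrite xm andbT.
by apply: (subsetP (window_sub_wexc_unif i kn)); rewrite inE; lia.
Qed.

(** A frozen [j] keeps its value and decoration. An unfrozen [j] other than [p] receives the value
    of the next unfrozen position [q], which comes after [j] and no later than [p]; so [q] is in the
    window, and its value is at least as far from [i] as [q]. *)
Lemma window_sub_wexc_shift n k (A : {set 'I_n}) (i p : 'I_n)
    (U := [set j | unif_perm n k j \notin A]) :
  0 < k <= n -> is_last k U i p ->
  window i k :\ p \subset wexc (shift A (unif_dperm n k)) i.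
Proof.
move=> /[dup] kn /andP[_ kn'] lp; apply/subsetP => j; rewrite !inE => /andP[jp jk].
rewrite /clt /= [shift_perm _ _ _]permE /shift_fun /=; have [jA|jA] := boolP (unif_perm n k j \in A).
  have ju : j \notin unfrozen A (unif_dperm n k) by rewrite mem_enum inE /= jA.
  rewrite next_nth (negbTE ju) andbT.
  by have /subsetP/(_ j) := window_sub_wexc_unif i kn; rewrite !inE; apply.
have [pU pk _] := and3P lp.
have jU : j \in U by rewrite inE.
have := is_last_le lp jU jk.
have := @clt_cpos_next n _ j p (sorted_enum_ord U); rewrite !mem_enum eq_sym.
move=> /(_ jU pU jp); set q := next _ j => jq jip.
apply/orP; right.
have : cpos i j < cpos i q <= cpos i p.
  have := cposD i j p; have := cposD i j q; have := cpos_lt j q.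
  have := cpos_lt i q; have := cpos_lt j p; lia.
by case/andP=> iq qp; rewrite cpos_unif_perm //; lia.
Qed.

Theorem theorem28 (n k l : nat) (hk : 1 <= k) (hkn : k <= n)
    (hl : l <= k - 1) (A : {set 'I_n}) (hA : #|A| = l)
    (s : dperm n) (hs : num_wexc s = k - 1)
    (hsA : s = shift A (unif_dperm n k)) :
  lessdot s (unif_dperm n k) /\ quotient_of (positroid s) (uniform hkn).
Proof.
have kn : 0 < k <= n by rewrite hk.
have rs : (num_wexc s).+1 = k by lia.
pose U := [set j | unif_perm n k j \notin A].
have cU : #|~: U| < k.
  have -> : ~: U = unif_perm n k @^-1: A by apply/setP => j; rewrite !inE negbK.
  by rewrite card_preimset ?hA //; [lia|exact: perm_inj].
have cB (B : {set 'I_n}) : B \in positroid_bases s -> #|B|.+1 = k by rewrite inE => /andP[/eqP-> _].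
have sp : forall D : {set 'I_n}, #|D| = k -> exists2 B : {set 'I_n}, B \in positroid_bases s & B \subset D.
  apply: (exists_basis_in hkn cU rs) => i p lp; rewrite hsA; exact: window_sub_wexc_shift lp.
have kT : k <= #|'I_n| by rewrite card_ord.
(* The same criterion serves both descriptions of the uniform matroid: by cardinality, and as the
   positroid of the uniform permutation. *)
split; last exact: (quotient_of_uniform kT).
split; first by rewrite num_wexc_unif.
by apply: (quotient_of_uniform kT) => //; exact: positroid_bases_unif.
Qed.
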